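(* Let $(X,\tau,\mathfrak a)$ be an aura topological space with $X=\{x_1,\dots,x_n\}$ finite, $|X|=n$. The following algorithm computes the aura-Levine equivalence $\equiv_{\mathfrak a}$ on subsets of $X$. 1. Build from the scope table (the list of the sets $\mathfrak a(x_1),\dots,\mathfrak a(x_n)$) the $n\times n$ Boolean adjacency matrix $M_{\mathfrak a}$, given by $(M_{\mathfrak a})_{ij}=1\iff x_j\in\mathfrak a(x_i)$. 2. Compute the Boolean reflexive-transitive closure $T_{\mathfrak a}$ of $M_{\mathfrak a}$ by Warshall's algorithm in $O(n^3)$ time. 3. For $A\subseteq X$, compute the Boolean vector $$h_A=\bigvee_{x_i\in A}\operatorname{row}_i(T_{\mathfrak a}),$$ where, when $A=\varnothing$, the empty Boolean join is understood to be the zero vector. Then $h_A$ is the characteristic vector of $K_{\mathfrak a}(A)$. 4. Decide whether $A\equiv_{\mathfrak a}B$ by testing whether $h_A=h_B$; that is, for all $A,B\subseteq X$, $$A\equiv_{\mathfrak a}B\iff h_A=h_B.$$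
   Context: An aura topological space is a triple $(X,\tau,\mathfrak a)$ where $X$ is a nonempty set, $(X,\tau)$ is a topological space and $\mathfrak a:X\to\tau$ (the scope function) satisfies $x\in\mathfrak a(x)$ for every $x\in X$. A set $U\subseteq X$ is $\mathfrak a$-open if $\{x\in U:\mathfrak a(x)\subseteq U\}=U$; the family of all $\mathfrak a$-open sets is denoted $\tau_{\mathfrak a}$ and is known to be a topology on $X$. For $A,B\subseteq X$, $A\equiv_{\mathfrak a}B$ (aura-Levine equivalence) means that for every $U\in\tau_{\mathfrak a}$, $A\subseteq U\iff B\subseteq U$. The canonical hull is $K_{\mathfrak a}(A)=\bigcap\{U\in\tau_{\mathfrak a}:A\subseteq U\}$. The Boolean reflexive-transitive closure of a Boolean matrix $M$ is the Boolean matrix of the reflexive-transitive closure of the relation on indices $\{(i,j):M_{ij}=1\}$. The join $\bigvee$ of Boolean vectors is taken coordinatewise, and $\operatorname{row}_i(T)$ denotes the $i$-th row of $T$. *)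

(* Defs.v *)
From HB Require Import structures.
From mathcomp Require Import all_boot all_order all_algebra.
From mathcomp Require Import all_classical topology.

Set Implicit Arguments.
Unset Strict Implicit.
Unset Printing Implicit Defensive.

Local Open Scope classical_set_scope.

(* [topologicalType] does not require a point, so nonemptiness is a field. *)
Record aura (X : topologicalType) := Aura {
  scope :> X -> set X;
  aura_nonempty : [set: X] !=set0;
  scope_open : forall x, open (scope x);
  scope_mem : forall x, scope x x }.

Section AuraSpace.
Variables (X : topologicalType) (a : aura X).

Definition aura_open : set (set X) :=
  [set U | [set x | U x /\ a x `<=` U] = U].

Definition aura_equiv (A B : set X) : Prop :=
  forall U, aura_open U -> (A `<=` U <-> B `<=` U).

Definition hull (A : set X) : set X :=
  \bigcap_(U in [set U | aura_open U /\ A `<=` U]) U.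

End AuraSpace.

(* Boolean matrices and vectors are matrices over [bool], used without any
   ring structure; they are indexed through an enumeration [x] of X. *)
Section BooleanMatrices.
Variables (X : topologicalType) (n : nat).
Implicit Types (x : 'I_n -> X) (M T : 'M[bool]_n) (A : set X).

Definition adjacency (a : aura X) x : 'M[bool]_n :=
  (\matrix_(i, j) (x j \in a (x i)))%R.

Definition rtclosure M : 'M[bool]_n :=
  (\matrix_(i, j) connect (fun p q => M p q) i j)%R.

Definition bool_join (u v : 'rV[bool]_n) : 'rV[bool]_n := map2_mx orb u v.

Definition hull_vector x T A : 'rV[bool]_n :=
  \big[bool_join/const_mx false]_(i < n | x i \in A) row i T.

Definition char_vector x A : 'rV[bool]_n :=
  (\row_j (x j \in A))%R.

End BooleanMatrices.

(* A small imperative language with one mutable n x n Boolean array, used to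
   give running times a meaning.  Unit-cost model: one step for each constant,
   array read, Boolean connective, array write and loop iteration. *)
Section Programs.
Variable n : nat.

Inductive bexp : Type :=
| Const of bool
| Get of 'I_n & 'I_n
| And of bexp & bexp
| Or of bexp & bexp.

Inductive cmd : Type :=
| Put of 'I_n & 'I_n & bexp
| Seq of cmd & cmd
| For of ('I_n -> cmd).

Implicit Types (M : 'M[bool]_n).

Fixpoint bexp_value M (e : bexp) : bool :=
  match e with
  | Const b => b
  | Get i j => M i j
  | And e1 e2 => bexp_value M e1 && bexp_value M e2
  | Or e1 e2 => bexp_value M e1 || bexp_value M e2
  end.

Fixpoint bexp_time (e : bexp) : nat :=
  match e with
  | Const _ | Get _ _ => 1
  | And e1 e2 | Or e1 e2 => (bexp_time e1 + bexp_time e2).+1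
  end.

(* The final array together with the number of steps; [For] runs through the
   indices in increasing order. *)
Fixpoint exec (c : cmd) M : 'M[bool]_n * nat :=
  match c with
  | Put i j e =>
      ((\matrix_(p, q) (if (p == i) && (q == j) then bexp_value M e else M p q))%R,
       (bexp_time e).+1)
  | Seq c1 c2 =>
      let: (M1, t1) := exec c1 M in
      let: (M2, t2) := exec c2 M1 in
      (M2, t1 + t2)
  | For body =>
      foldl (fun s i => let: (N, t) := exec (body i) s.1 in (N, (s.2 + t).+1))
            (M, 0) (enum 'I_n)
  end.

(* Warshall's algorithm, in place; the first loop sets the diagonal, so that
   the result is the reflexive-transitive and not just the transitive closure. *)
Definition warshall : cmd :=
  Seq (For (fun i => Put i i (Const true)))
      (For (fun k => For (fun i => For (fun j =>
         Put i j (Or (Get i j) (And (Get i k) (Get k j))))))).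

End Programs.

(* Main.v *)
Require Import Defs.
From HB Require Import structures.
From mathcomp Require Import all_boot all_order all_algebra.
From mathcomp Require Import all_classical topology.

Set Implicit Arguments.
Unset Strict Implicit.
Unset Printing Implicit Defensive.

Local Open Scope classical_set_scope.

(** Two independent facts give the theorem.

    Warshall's loops compute the closure.  A round with pivot [k] replaces a
    relation [R] by [R i j || (R i k && R k j)].  The array is overwritten while
    it is being read, but row [k] and column [k] do not change during their own
    round, so the in-place round has the same result as a simultaneous update
    ([exec_round]).  A relation is transitive exactly when every index [l] is a
    valid midpoint: [R i l] and [R l j] imply [R i j].  A round makes its pivot
    a valid midpoint and keeps the earlier midpoints valid
    ([pivot_step_midpoint]); since the diagonal was set beforehand, the final
    array is reflexive and transitive.  It contains [M], and each update only
    adds pairs that are connected in [M], so it is the reflexive-transitive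
    closure ([warshall_correct]).  The time of each loop body does not depend
    on the array, so the total time is an explicit cubic polynomial.

    A set [U] is aura-open exactly when it is closed under the steps [y] to [z]
    with [z] in [a y].  The smallest such set containing [A] is therefore the
    set of points reachable from [A] ([hullP]), which is what the join of the
    rows of the closure lists.  Finally, [A] and its hull lie in the same
    aura-open sets, so equivalence of [A] and [B] is equality of their hulls
    ([aura_equiv_hull]). *)

(** * Loops *)

Section Loops.
Variable n : nat.
Implicit Types (M N : 'M[bool]_n) (body : 'I_n -> cmd n).

(** The Hoare rule for [For]: the invariant may mention the list of indices
    already processed. *)
Lemma exec_For_ind (P : seq 'I_n -> 'M[bool]_n -> Prop) body M :
  P [::] M ->
  (forall s i N, P s N -> P (rcons s i) (exec (body i) N).1) ->
  P (enum 'I_n) (exec (For body) M).1.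
Proof.
move=> P0 PS /=; rewrite -[X in P X]cat0s.
have: P [::] (M, 0).1 by [].
elim: (enum _) {P0} [::] (M, 0) => [|i r IHr] s p Pp; first by rewrite cats0.
rewrite -cat_rcons [foldl _ _ _]/=; apply: IHr.
by have := PS _ i _ Pp; case: (exec _ _).
Qed.

Lemma time_For (t : nat) body M :
  (forall i N, (exec (body i) N).2 = t) ->
  (exec (For body) M).2 = n * t.+1.
Proof.
move=> tE /=.
have -> : n * t.+1 = (M, 0).2 + size (enum 'I_n) * t.+1 by rewrite size_enum_ord.
elim: (enum _) (M, 0) => [|i r IHr] s; first by rewrite addn0.
rewrite [LHS]/= IHr; have := tE i s.1; case: (exec _ _) => N u /= ->.
by rewrite mulSn addnA addnS.
Qed.

Lemma exec_Seq (c1 c2 : cmd n) M :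
  exec (Seq c1 c2) M =
  ((exec c2 (exec c1 M).1).1, (exec c1 M).2 + (exec c2 (exec c1 M).1).2).
Proof. by rewrite /=; case: (exec c1 M) => M1 t1; case: (exec c2 M1). Qed.

End Loops.

(** * Warshall's algorithm *)

Section Warshall.
Variable n : nat.
Implicit Types (M N : 'M[bool]_n) (D : rel 'I_n) (i j k l p q : 'I_n).

Definition diagonal_loop : cmd n := For (fun i => Put i i (Const _ true)).

Definition update k i j : cmd n :=
  Put i j (Or (Get i j) (And (Get i k) (Get k j))).

Definition round k : cmd n := For (fun i => For (fun j => update k i j)).

(** The array in the course of a round with pivot [k], once the entries in [D]
    have been updated. *)
Definition pivot_step D k M : 'M[bool]_n :=
  (\matrix_(p, q) (M p q || [&& D p q, M p k & M k q]))%R.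

(** Overwriting in place is harmless: at [q = k] the added conjunction already
    contains [M p q], and likewise at [p = k], so the two entries that the
    update reads besides its target still have their initial values. *)
Lemma exec_update D k i j M :
  (exec (update k i j) (pivot_step D k M)).1 =
  pivot_step (fun p q => D p q || ((p == i) && (q == j))) k M.
Proof.
apply/matrixP=> p q; rewrite !mxE /=.
case: ifP => [/andP[/eqP-> /eqP->]|_]; last by rewrite orbF.
rewrite !mxE orbT.
by case: (M i j) (D i j) (D i k) (D k j) (M i k) (M k j) (M k k)
  => [] [] [] [] [] [] [].
Qed.

Lemma exec_round k M : (exec (round k) M).1 = pivot_step (fun _ _ => true) k M.
Proof.
have inner D i : (exec (For (fun j => update k i j)) (pivot_step D k M)).1 =
    pivot_step (fun p q => D p q || (p == i)) k M.
  pose done (s : seq 'I_n) :=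
    pivot_step (fun p q => D p q || ((p == i) && (q \in s))) k M.
  have -> : pivot_step (fun p q => D p q || (p == i)) k M = done (enum 'I_n).
    by apply/matrixP=> p q; rewrite !mxE mem_enum andbT.
  apply: (@exec_For_ind _ (fun s N => N = done s)) => [|s j N ->].
    by apply/matrixP=> p q; rewrite !mxE andbF orbF.
  rewrite exec_update; apply/matrixP=> p q; rewrite !mxE mem_rcons inE.
  by rewrite -orbA -andb_orr [(q \in s) || _]orbC.
pose done (s : seq 'I_n) := pivot_step (fun p _ => p \in s) k M.
have -> : pivot_step (fun _ _ => true) k M = done (enum 'I_n).
  by apply/matrixP=> p q; rewrite !mxE mem_enum.
apply: (@exec_For_ind _ (fun s N => N = done s)) => [|s i N ->].
  by apply/matrixP=> p q; rewrite !mxE orbF.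
rewrite inner; apply/matrixP=> p q; rewrite !mxE mem_rcons inE.
by rewrite [(p == i) || _]orbC.
Qed.

Definition midpoint M l := forall i j, M i l -> M l j -> M i j.

(** A new pair through an old midpoint [l] either comes from two old pairs, or
    one of its halves passes through [k]; in the latter case the midpoint
    property of [l] joins the remaining piece to [k]. *)
Lemma pivot_step_midpoint k l M :
  l = k \/ midpoint M l -> midpoint (pivot_step (fun _ _ => true) k M) l.
Proof.
rewrite /midpoint => lM i j; rewrite !mxE /=.
case: lM => [->|lM].
  have -> : M i k || M i k && M k k = M i k by case: (M i k).
  by move=> -> /orP[-> | /andP[_ ->]]; rewrite orbT.
case/orP=> [il|/andP[ik kl]] /orP[lj|/andP[lk kj]].
- by rewrite (lM i j).
- by rewrite (lM i k) // kj orbT.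
- by rewrite ik (lM k j) // orbT.
- by rewrite ik kj orbT.
Qed.

Lemma exec_diagonal_loop M :
  (exec diagonal_loop M).1 = (\matrix_(p, q) ((p == q) || M p q))%R.
Proof.
pose done (s : seq 'I_n) : 'M[bool]_n :=
  (\matrix_(p, q) ((p == q) && (p \in s) || M p q))%R.
have -> : (\matrix_(p, q) ((p == q) || M p q))%R = done (enum 'I_n).
  by apply/matrixP=> p q; rewrite !mxE mem_enum andbT.
apply: (@exec_For_ind _ (fun s N => N = done s)) => [|s i N ->].
  by apply/matrixP=> p q; rewrite !mxE andbF.
apply/matrixP=> p q; rewrite !mxE mem_rcons inE /=.
by case: (eqVneq p i) => [->|_] //=; case: (eqVneq q i).
Qed.

Lemma warshall_correct M : (exec (warshall n) M).1 = rtclosure M.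
Proof.
pose R := connect (fun p q => M p q).
pose Inv (s : seq 'I_n) N :=
  [/\ forall p, N p p, forall p q, M p q -> N p q,
      forall p q, N p q -> R p q & forall l, l \in s -> midpoint N l].
rewrite /warshall exec_Seq exec_diagonal_loop /=.
set N0 := (\matrix_(p, q) _)%R.
have: Inv (enum 'I_n) (exec (For round) N0).1.
  apply: exec_For_ind => [|s k N [Nrefl MN NR mid]].
    split=> [p|p q|p q|//]; rewrite mxE; first by rewrite eqxx.
      by move=> ->; rewrite orbT.
    by case/orP=> [/eqP->|Mpq]; [exact: connect0|exact: connect1].
  rewrite exec_round; split=> [p|p q|p q|l].
  - by rewrite mxE Nrefl.
  - by move=> /MN Npq; rewrite mxE Npq.
  - rewrite mxE => /orP[/NR //|/and3P[_ /NR pk /NR kq]].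
    exact: connect_trans pk kq.
  - rewrite mem_rcons inE => /orP[/eqP lk|/mid lN].
      by apply: pivot_step_midpoint; left.
    by apply: pivot_step_midpoint; right.
case=> Nrefl MN NR mid; apply/matrixP=> i j; rewrite [RHS]mxE.
apply/idP/idP=> [/NR //|/connectP[s]].
elim: s i => [|k s IHs] i /= => [_ ->|/andP[/MN Nik ks] jE]; first exact: Nrefl.
by apply: (mid k) => //; [rewrite mem_enum|exact: IHs].
Qed.

(** One update takes 6 steps and one diagonal write 2; each loop adds one step
    per iteration. *)
Lemma time_warshall M :
  (exec (warshall n) M).2 = n * 3 + n * (n * (n * 7).+1).+1.
Proof.
rewrite /warshall exec_Seq; apply: (f_equal2 addn); first exact: time_For.
apply: time_For => k N; apply: time_For => i N'; exact: time_For.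
Qed.

End Warshall.

(** * Hulls and reachability *)

Section Hull.
Variables (X : topologicalType) (a : aura X).
Implicit Types (A B U : set X).

Lemma aura_openP U : aura_open a U <-> forall y, U y -> a y `<=` U.
Proof.
split=> [UE y Uy|Ucl].
  by have [] : [set z | U z /\ a z `<=` U] y by rewrite UE.
by apply/seteqP; split=> [y []|y Uy] //; split=> //; exact: Ucl.
Qed.

Lemma sub_hull A : A `<=` hull a A.
Proof. by move=> y Ay U [_]; apply. Qed.

Lemma hull_sub A U : aura_open a U -> A `<=` U -> hull a A `<=` U.
Proof. by move=> oU AU y; apply. Qed.

Lemma aura_equiv_hull A B : aura_equiv a A B <-> hull a A = hull a B.
Proof.
split=> [eqAB|hE U oU].
  by apply/seteqP; split=> y hy U [oU] /(eqAB U oU) sU; apply: hy.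
split=> [AU|BU].
  by apply: subset_trans (@sub_hull B) _; rewrite -hE; exact: hull_sub.
by apply: subset_trans (@sub_hull A) _; rewrite hE; exact: hull_sub.
Qed.

Variables (n : nat) (x : 'I_n -> X).
Hypothesis x_bij : bijective x.

(** The points reachable from [A] are closed under steps, hence form an
    aura-open set containing [A]; conversely an aura-open set containing the
    start of a path contains its end. *)
Lemma hullP A (j : 'I_n) :
  hull a A (x j) <-> exists2 i, A (x i) & rtclosure (adjacency a x) i j.
Proof.
have [g xK gK] := x_bij; split=> [hj|[i Ai]].
  pose U := [set y | exists2 i, A (x i) & rtclosure (adjacency a x) i (g y)].
  suff: U (x j) by case=> i Ai; rewrite xK; exists i.
  apply: hj; split=> [|y Ay].
    apply/aura_openP=> y [i Ai]; rewrite mxE => iy z yz; exists i => //.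
    rewrite mxE; apply: connect_trans iy (connect1 _).
    by rewrite mxE !gK; exact/mem_set.
  by exists (g y); rewrite ?gK // mxE connect0.
rewrite mxE => /connectP[s ps ->] U [/aura_openP Ucl /(_ _ Ai)].
elim: s i ps {Ai} => [|k s IHs] i //= /andP[ik ks] Ui.
by apply: IHs => //; apply: Ucl Ui _ _; move: ik; rewrite mxE => /set_mem.
Qed.

Lemma hull_vectorE (T : 'M[bool]_n) A (j : 'I_n) :
  hull_vector x T A ord0 j = [exists (i | x i \in A), T i j].
Proof.
rewrite -big_orE /hull_vector.
rewrite (big_morph (fun v : 'rV[bool]_n => v ord0 j) (id1 := false) (op1 := orb)).
- by apply: eq_bigr => i _; rewrite mxE.
- by move=> u v; rewrite mxE.
- by rewrite mxE.
Qed.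

Lemma hull_vector_correct A :
  hull_vector x (rtclosure (adjacency a x)) A = char_vector x (hull a A).
Proof.
apply/rowP=> j; rewrite hull_vectorE mxE; apply/existsP/idP.
  by case=> i /andP[/set_mem Ai Tij]; apply/mem_set/hullP; exists i.
move=> /set_mem/hullP[i Ai Tij]; exists i; apply/andP; split=> //.
exact/mem_set.
Qed.

Lemma char_vector_inj : injective (char_vector x).
Proof.
have [g _ gK] := x_bij => A B /rowP AB; apply/seteqP; split=> y.
  by move=> /mem_set Ay; have := AB (g y); rewrite !mxE gK Ay => /esym/set_mem.
by move=> /mem_set By; have := AB (g y); rewrite !mxE gK By => /set_mem.
Qed.

End Hull.

Theorem mainTheorem10 :
  exists C : nat,
  forall (X : topologicalType) (a : aura X) (n : nat) (x : 'I_n -> X),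
  bijective x ->
  let M := adjacency a x in
  let T := (exec (warshall n) M).1 in
  let time := (exec (warshall n) M).2 in
  let h := hull_vector x T in
  [/\ T = rtclosure M,
      (time <= C * n ^ 3)%N,
      forall A : set X, h A = char_vector x (hull a A)
    & forall A B : set X, aura_equiv a A B <-> h A = h B].
Proof.
(* The time is [7 * n ^ 3 + n ^ 2 + 4 * n], and [12 = 7 + 1 + 4]. *)
exists 12 => X a n x x_bij M T time h.
have TE : T = rtclosure M by exact: warshall_correct.
have hE A : h A = char_vector x (hull a A).
  by rewrite /h TE hull_vector_correct.
split=> // [|A B].
  rewrite /time time_warshall; case: n {x x_bij M T time h TE hE} => // m.
  have le1 : m.+1 <= m.+1 ^ 3 by rewrite -{1}(expn1 m.+1) leq_pexp2l.
  have le2 : m.+1 ^ 2 <= m.+1 ^ 3 by rewrite leq_pexp2l.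
  have -> : m.+1 * 3 + m.+1 * (m.+1 * (m.+1 * 7).+1).+1 =
      7 * m.+1 ^ 3 + m.+1 ^ 2 + 4 * m.+1.
    rewrite -[(m.+1 * 7).+1]addn1 -[(m.+1 * (m.+1 * 7 + 1)).+1]addn1.
    rewrite !mulnDr !muln1 !mulnA !(mulnC _ 7) (mulnC _ 3) !expnS expn0 muln1.
    by rewrite !mulnA addnC -addnA -(mulSn 3 m.+1).
  rewrite -[12]/(7 + 1 + 4) !mulnDl mul1n.
  by rewrite leq_add ?leq_mul2l ?leq_add2l ?le1.
by rewrite aura_equiv_hull !hE; split=> [->|/(char_vector_inj x_bij)].
Qed.
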